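(* Let $\mathbf{k}$ be a commutative ring whose additive group is torsionfree, and let $L$ be a free $\mathbf{k}$-module. Then $(\overline{\mathfrak{g}}')^{\star}=\operatorname{Ker}(\mathbf{t}')$.
   Context: Let $\mathbb{N}=\{0,1,2,\ldots\}$; all tensor products are over $\mathbf{k}$. $T(L)=\bigoplus_{n\in\mathbb{N}} L^{\otimes n}$ is the tensor algebra of $L$ (product = concatenation of tensors); $L$ is identified with $L^{\otimes 1}$. $\mathbf{t}':T(L)\to T(L)$ is the $\mathbf{k}$-linear map given by $\mathbf{t}'(u_1\otimes u_2\otimes\cdots\otimes u_k)=\sum_{i=1}^{k}u_i\otimes u_1\otimes u_2\otimes\cdots\otimes\widehat{u_i}\otimes\cdots\otimes u_k$ for all $k\in\mathbb{N}$ and $u_1,\ldots,u_k\in L$, where $\widehat{u_i}$ means that the factor $u_i$ is omitted from its usual place (so $\mathbf{t}'$ is $0$ on $L^{\otimes 0}$). The commutator on $T(L)$ is $[U,V]=UV-VU$. For $\mathbf{k}$-submodules $A,B$ of $T(L)$, $[A,B]$ denotes the $\mathbf{k}$-linear span of all $[U,V]$ with $U\in A$, $V\in B$. Define $\mathbf{k}$-submodules $L'_1,L'_2,L'_3,\ldots$ of $T(L)$ recursively by $L'_1=L$ and $L'_{i+1}=[L,L'_i]$. Let $\overline{\mathfrak{g}}'=L'_2+L'_3+L'_4+\cdots$. For a $\mathbf{k}$-submodule $U$ of a $\mathbf{k}$-algebra $A$, $U^{\star}=U^0+U^1+U^2+\cdots$ denotes the $\mathbf{k}$-subalgebra of $A$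 generated by $U$, where $U^i=UU\cdots U$ ($i$ factors) and $U^0=\mathbf{k}\cdot 1_A$. *)

(* Defs.v *)
From HB Require Import structures.
From mathcomp Require Import all_boot all_algebra.
From mathcomp Require Import generic_quotient ring_quotient.
From mathcomp Require Import finmap.
From mathcomp Require Import boolp classical_sets.
From mathcomp.multinomials Require Import monalg.

Set Implicit Arguments.
Unset Strict Implicit.
Unset Printing Implicit Defensive.

Import GRing.Theory.
Local Open Scope classical_set_scope.
Local Open Scope ring_scope.
Local Open Scope quotient_scope.

(* Base rings are comPzRingType: the zero ring is allowed, as in the usual
   definition of a commutative ring. *)

Definition torsionfree (V : zmodType) : Prop :=
  forall (n : nat) (x : V), (0 < n)%N -> x *+ n = 0 -> x = 0.

Section Modules.
Variables (k : comPzRingType) (V : lmodType k).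

Definition span (S : set V) : set V :=
  [set v | exists s : seq (k * V),
     (forall p, p \in s -> S p.2) /\ v = \sum_(p <- s) p.1 *: p.2].

Definition lin_indep (B : set V) : Prop :=
  forall (s : seq V) (c : V -> k), uniq s -> (forall x, x \in s -> B x) ->
    \sum_(x <- s) c x *: x = 0 -> forall x, x \in s -> c x = 0.

Definition is_free : Prop :=
  exists B : set V, lin_indep B /\ span B = setT.

Lemma span0 S : span S 0.
Proof. by exists [::]; rewrite big_nil. Qed.

Lemma span_gen (S : set V) x : S x -> span S x.
Proof.
move=> Sx; exists [:: (1, x)]; split; last by rewrite big_seq1 scale1r.
by move=> p; rewrite inE => /eqP ->.
Qed.

Lemma spanD S x y : span S x -> span S y -> span S (x + y).
Proof.
move=> [s [hs ->]] [t [ht ->]]; exists (s ++ t); rewrite big_cat; split=> // p.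
by rewrite mem_cat => /orP[/hs|/ht].
Qed.

Lemma spanZ S a x : span S x -> span S (a *: x).
Proof.
move=> [s [hs ->]]; exists [seq (a * p.1, p.2) | p <- s]; split.
  by move=> p /mapP[q /hs hq ->].
by rewrite big_map scaler_sumr; apply: eq_bigr => p _; rewrite scalerA.
Qed.

Lemma span_ind (S P : set V) :
  P 0 -> (forall a x y, S x -> P y -> P (a *: x + y)) -> span S `<=` P.
Proof.
move=> P0 PD _ [s [hs ->]]; elim: s hs => [|p s IHs] hs; first by rewrite big_nil.
rewrite big_cons; apply: PD; first by apply: hs; rewrite mem_head.
by apply: IHs => q qs; apply: hs; rewrite inE qs orbT.
Qed.

End Modules.

(* The free module on K.  This is an alias of {malg k[K]}, whose own module
   structure is only declared for a nonzero base ring. *)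
Definition freemod (k : comPzRingType) (K : choiceType) := {malg k[K]}.

Section FreeModule.
Variables (k : comPzRingType) (K : choiceType).
Local Notation F := (freemod k K).

HB.instance Definition _ := GRing.Zmodule.on F.

Definition coef (x : K) (g : F) : k := mcoeff x g.

Definition gen (x : K) : F := << 1 *g x >>.

Definition fm_scale (a : k) (g : F) : F :=
  [malg x in msupp g => a * coef x g].

Lemma freemodP (g h : F) : (forall x, coef x g = coef x h) <-> g = h.
Proof. exact: malgP. Qed.

Lemma coefD x (g h : F) : coef x (g + h) = coef x g + coef x h.
Proof. exact: (@mcoeffD K k x). Qed.

Lemma coef_scale x a (g : F) : coef x (fm_scale a g) = a * coef x g.
Proof.
rewrite /coef /fm_scale mcoeffE; case: ifPn => // xg.
by rewrite mcoeff_outdom // mulr0.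
Qed.

Lemma coef_gen x y : coef y (gen x) = (x == y)%:R.
Proof. exact: mcoeffU. Qed.

Fact fm_scalerA a b (g : F) : fm_scale a (fm_scale b g) = fm_scale (a * b) g.
Proof. by apply/freemodP => x; rewrite !coef_scale mulrA. Qed.

Fact fm_scale1r : left_id 1 fm_scale.
Proof. by move=> g; apply/freemodP => x; rewrite coef_scale mul1r. Qed.

Fact fm_scalerDr : right_distributive fm_scale +%R.
Proof.
by move=> a g h; apply/freemodP => x; rewrite coefD !coef_scale coefD mulrDr.
Qed.

Fact fm_scalerDl (g : F) : {morph fm_scale^~ g : a b / a + b}.
Proof.
by move=> a b; apply/freemodP => x; rewrite coefD !coef_scale mulrDl.
Qed.

HB.instance Definition _ :=
  GRing.Zmodule_isLmodule.Build k F
    fm_scalerA fm_scale1r fm_scalerDr fm_scalerDl.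

Lemma coefZ x a (g : F) : coef x (a *: g) = a * coef x g.
Proof. exact: coef_scale. Qed.

Lemma coef_supp x (g : F) : x \notin msupp g -> coef x g = 0.
Proof. exact: mcoeff_outdom. Qed.

Section Extension.
Variable V : lmodType k.
Implicit Type f : K -> V.

Definition lext f (g : F) : V := \sum_(x <- msupp g) coef x g *: f x.

Lemma lextE f (g : F) (d : {fset K}) :
  (msupp g `<=` d)%fset -> lext f g = \sum_(x <- d) coef x g *: f x.
Proof.
move=> gd; apply: (big_fset_incl _ gd) => x _ xg.
by rewrite coef_supp // scale0r.
Qed.

Fact lext_is_linear f : linear (lext f).
Proof.
move=> a g h.
pose d := (msupp (a *: g + h) `|` (msupp g `|` msupp h))%fset.
rewrite (@lextE f _ d) ?fsubsetUl //.
rewrite (@lextE f g d); last by rewrite fsubsetU // fsubsetUl orbT.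
rewrite (@lextE f h d); last by rewrite fsubsetU // fsubsetUr orbT.
rewrite scaler_sumr -big_split; apply: eq_bigr => x _ /=.
by rewrite coefD coefZ scalerDl scalerA.
Qed.
HB.instance Definition _ f :=
  GRing.isLinear.Build k F V *:%R (lext f) (lext_is_linear f).

Lemma lextP f a (g h : F) : lext f (a *: g + h) = a *: lext f g + lext f h.
Proof. exact: lext_is_linear. Qed.

Lemma lextB f (g h : F) : lext f (g - h) = lext f g - lext f h.
Proof. exact: linearB. Qed.

Lemma lext_gen f x : lext f (gen x) = f x.
Proof.
rewrite (@lextE f _ [fset x]%fset) ?msuppU_le //.
by rewrite big_seq_fset1 coef_gen eqxx scale1r.
Qed.

End Extension.

Lemma freemodE (g : F) : g = \sum_(x <- msupp g) coef x g *: gen x.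
Proof.
rewrite {1}[g]monalgE; apply: eq_bigr => x _; apply/freemodP => y.
by rewrite coefZ coef_gen /coef mcoeffU mulr_natr.
Qed.

Lemma freemod_ind (P : F -> Prop) :
  P 0 -> (forall a x g, P g -> P (a *: gen x + g)) -> forall g, P g.
Proof.
move=> P0 PD g; rewrite [g]freemodE.
elim: (X in \sum_(x <- X) _) => [|x s IHs]; first by rewrite big_nil.
by rewrite big_cons; apply: PD.
Qed.

End FreeModule.

(* T(L) = (+)_n L^{(x) n}.  Each L^{(x) n} is the free module on L^n modulo
   multilinearity; since multilinearity relates only tuples of equal length,
   the direct sum is the free module on all words (seq L) modulo
   multilinearity in each letter. *)
Section TensorAlgebra.
Variables (k : comPzRingType) (L : lmodType k).
Local Notation F := (freemod k (seq L)).

Definition multilin_rel : set F :=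
  [set r | exists (s t : seq L) (a : k) (u v : L),
     r = gen k (s ++ (a *: u + v) :: t)
         - (a *: gen k (s ++ u :: t) + gen k (s ++ v :: t))].

Definition multilin : {pred F} := fun g => `[< span multilin_rel g >].

Lemma multilinP g : reflect (span multilin_rel g) (g \in multilin).
Proof. exact: asboolP. Qed.

Fact multilin_zmod_closed : zmod_closed multilin.
Proof.
split=> [|x y /multilinP hx /multilinP hy]; first exact/multilinP/span0.
by apply/multilinP/spanD => //; rewrite -scaleN1r; apply: spanZ.
Qed.
HB.instance Definition _ := GRing.isZmodClosed.Build F multilin
  multilin_zmod_closed.

Lemma multilinZ a g : g \in multilin -> a *: g \in multilin.
Proof. by move=> /multilinP hg; apply/multilinP/spanZ. Qed.

Definition tensor_alg : Type := Quotient.quot multilin.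
Local Notation T := tensor_alg.

HB.instance Definition _ := GRing.Zmodule.on T.

Definition tpi (g : F) : T := \pi_(Quotient.quot multilin) g.

Lemma tpiD g h : tpi (g + h) = tpi g + tpi h.
Proof. exact: (raddfD (\pi_(Quotient.quot multilin))). Qed.

Lemma tpiB g h : tpi (g - h) = tpi g - tpi h.
Proof. exact: (raddfB (\pi_(Quotient.quot multilin))). Qed.

Lemma tpi0 : tpi 0 = 0.
Proof. exact: (raddf0 (\pi_(Quotient.quot multilin))). Qed.

Lemma tpi_eq g h : reflect (tpi g = tpi h) (g - h \in multilin).
Proof. by rewrite Quotient.idealrBE; apply: eqP. Qed.

Lemma tpi_repr (z : T) : tpi (repr z) = z.
Proof. exact: reprK. Qed.

Lemma repr_tpi g : repr (tpi g) - g \in multilin.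
Proof. by apply/tpi_eq; rewrite tpi_repr. Qed.

Definition ta_scale (a : k) (z : T) : T := tpi (a *: repr z).

Lemma ta_scaleE a g : ta_scale a (tpi g) = tpi (a *: g).
Proof. by apply/tpi_eq; rewrite -scalerBr multilinZ // repr_tpi. Qed.

Fact ta_scalerA a b z : ta_scale a (ta_scale b z) = ta_scale (a * b) z.
Proof. by rewrite -[z]tpi_repr !ta_scaleE scalerA. Qed.

Fact ta_scale1r : left_id 1 ta_scale.
Proof. by move=> z; rewrite -[z]tpi_repr !ta_scaleE scale1r. Qed.

Fact ta_scalerDr : right_distributive ta_scale +%R.
Proof.
move=> a y z; rewrite -[y]tpi_repr -[z]tpi_repr -tpiD !ta_scaleE.
by rewrite scalerDr tpiD.
Qed.

Fact ta_scalerDl z : {morph ta_scale^~ z : a b / a + b}.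
Proof. by move=> a b; rewrite -[z]tpi_repr !ta_scaleE scalerDl tpiD. Qed.

HB.instance Definition _ :=
  GRing.Zmodule_isLmodule.Build k T
    ta_scalerA ta_scale1r ta_scalerDr ta_scalerDl.

Lemma tpiZ a g : tpi (a *: g) = a *: tpi g.
Proof. by rewrite -ta_scaleE. Qed.

Fact tpi_is_linear : linear tpi.
Proof. by move=> a g h; rewrite tpiD tpiZ. Qed.
HB.instance Definition _ :=
  GRing.isLinear.Build k F T *:%R tpi tpi_is_linear.

Definition tensor (s : seq L) : T := tpi (gen k s).

Lemma tensor_lin s t a u v :
  tensor (s ++ (a *: u + v) :: t)
  = a *: tensor (s ++ u :: t) + tensor (s ++ v :: t).
Proof.
rewrite /tensor -tpiZ -tpiD; apply/tpi_eq/multilinP/span_gen.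
by exists s, t, a, u, v.
Qed.

Lemma tensor_ind (P : T -> Prop) :
  P 0 -> (forall a s z, P z -> P (a *: tensor s + z)) -> forall z, P z.
Proof.
move=> P0 PD z; rewrite -[z]tpi_repr.
elim/freemod_ind: (repr z) => [|a s g IH]; first by rewrite tpi0.
by rewrite tpiD tpiZ; apply: PD.
Qed.

(* Universal property of T(L) as a module: a family of multilinear maps on the
   L^n, presented as f : seq L -> V, extends linearly to T(L). *)
Section Extension.
Variable V : lmodType k.
Implicit Type f : seq L -> V.

Definition multilinear f : Prop :=
  forall s t a u v,
    f (s ++ (a *: u + v) :: t) = a *: f (s ++ u :: t) + f (s ++ v :: t).

Definition tlift f (z : T) : V := lext f (repr z).

Lemma lext_multilin f g : multilinear f -> g \in multilin -> lext f g = 0.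
Proof.
move=> fP /multilinP hg.
suff /(_ g hg) : span multilin_rel `<=` [set g | lext f g = 0] by [].
apply: span_ind => [|a x y] /=; first exact: linear0.
move=> [s [t [b [u [v ->]]]]] IH.
by rewrite lextP IH addr0 lextB lextP !lext_gen fP subrr scaler0.
Qed.

Lemma tlift_tpi f g : multilinear f -> tlift f (tpi g) = lext f g.
Proof.
move=> fP; apply/eqP; rewrite -subr_eq0 -lextB; apply/eqP.
exact: lext_multilin fP (repr_tpi g).
Qed.

Lemma tlift_tensor f s : multilinear f -> tlift f (tensor s) = f s.
Proof. by move=> fP; rewrite /tensor tlift_tpi // lext_gen. Qed.

Lemma tlift_linear f : multilinear f -> linear (tlift f).
Proof.
move=> fP a y z; rewrite -[y]tpi_repr -[z]tpi_repr -tpiZ -tpiD.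
by rewrite !tlift_tpi // lextP.
Qed.

End Extension.

Definition ta_one : T := tensor [::].

Definition ta_mul (y z : T) : T :=
  tlift (fun s => tlift (fun t => tensor (s ++ t)) z) y.

Fact cat_multilinear s : multilinear (fun t => tensor (s ++ t)).
Proof. by move=> s1 t a u v; rewrite !catA tensor_lin. Qed.

Fact catr_multilinear z :
  multilinear (fun s => tlift (fun t => tensor (s ++ t)) z).
Proof.
move=> s t a u v; elim/tensor_ind: z => [|b w z IH].
  have l0 s' : tlift (fun t => tensor (s' ++ t)) 0 = 0.
    by rewrite -tpi0 tlift_tpi ?linear0 //; apply: cat_multilinear.
  by rewrite !l0 scaler0 addr0.
rewrite !tlift_linear; try exact: cat_multilinear.
rewrite !tlift_tensor ?IH; try exact: cat_multilinear.
rewrite -!catA !cat_cons tensor_lin !scalerDr !scalerA (mulrC b a).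
by rewrite !addrA; congr (_ + _); rewrite addrAC.
Qed.

Fact ta_mulPl y a z1 z2 : ta_mul (a *: z1 + z2) y = a *: ta_mul z1 y + ta_mul z2 y.
Proof. by rewrite /ta_mul tlift_linear //; apply: catr_multilinear. Qed.

Fact ta_mul0l y : ta_mul 0 y = 0.
Proof.
by have := ta_mulPl y (-1) 0 0; rewrite !scaleN1r oppr0 addr0 addNr.
Qed.

Fact ta_mul_tensorl s z : ta_mul (tensor s) z = tlift (fun t => tensor (s ++ t)) z.
Proof. by rewrite /ta_mul tlift_tensor //; apply: catr_multilinear. Qed.

Fact ta_mulPr y a z1 z2 : ta_mul y (a *: z1 + z2) = a *: ta_mul y z1 + ta_mul y z2.
Proof.
elim/tensor_ind: y => [|b s y IH]; first by rewrite !ta_mul0l scaler0 addr0.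
rewrite !ta_mulPl IH !ta_mul_tensorl tlift_linear; last exact: cat_multilinear.
rewrite !scalerDr !scalerA (mulrC b a).
by rewrite !addrA; congr (_ + _); rewrite addrAC.
Qed.

Fact ta_mul0r y : ta_mul y 0 = 0.
Proof.
by have := ta_mulPr y (-1) 0 0; rewrite !scaleN1r oppr0 addr0 addNr.
Qed.

Fact ta_mul_tensor s t : ta_mul (tensor s) (tensor t) = tensor (s ++ t).
Proof. by rewrite ta_mul_tensorl tlift_tensor //; apply: cat_multilinear. Qed.

Fact ta_mulA : associative ta_mul.
Proof.
move=> x y z; elim/tensor_ind: x => [|a s x IHx]; first by rewrite !ta_mul0l.
rewrite !ta_mulPl IHx; congr (_ *: _ + _) => {x IHx}.
elim/tensor_ind: y => [|b t y IHy]; first by rewrite ?(ta_mul0l, ta_mul0r).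
rewrite !(ta_mulPl, ta_mulPr) IHy; congr (_ *: _ + _) => {y IHy}.
elim/tensor_ind: z => [|c u z IHz]; first by rewrite !ta_mul0r.
by rewrite !ta_mulPr IHz !ta_mul_tensor catA.
Qed.

Fact ta_mul1l : left_id ta_one ta_mul.
Proof.
elim/tensor_ind => [|a s z IH]; first by rewrite ta_mul0r.
by rewrite ta_mulPr IH ta_mul_tensor.
Qed.

Fact ta_mul1r : right_id ta_one ta_mul.
Proof.
elim/tensor_ind => [|a s z IH]; first by rewrite ta_mul0l.
by rewrite ta_mulPl IH ta_mul_tensor cats0.
Qed.

Fact ta_mulDl : left_distributive ta_mul +%R.
Proof. by move=> x y z; have := ta_mulPl z 1 x y; rewrite !scale1r. Qed.

Fact ta_mulDr : right_distributive ta_mul +%R.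
Proof. by move=> x y z; have := ta_mulPr x 1 y z; rewrite !scale1r. Qed.

HB.instance Definition _ := GRing.Zmodule_isPzRing.Build T
  ta_mulA ta_mul1l ta_mul1r ta_mulDl ta_mulDr.

(* MathComp's algType excludes the zero ring, so the two compatibility laws
   between scaling and product are given as lemmas. *)
Lemma ta_scalerAl a (y z : T) : a *: (y * z) = (a *: y) * z.
Proof. by have := ta_mulPl z a y 0; rewrite ta_mul0l !addr0. Qed.

Lemma ta_scalerAr a (y z : T) : a *: (y * z) = y * (a *: z).
Proof. by have := ta_mulPr y a z 0; rewrite ta_mul0r !addr0. Qed.

Lemma tensor_nil : tensor [::] = 1.
Proof. by []. Qed.

Lemma tensor_cat s t : tensor (s ++ t) = tensor s * tensor t.
Proof. by rewrite -ta_mul_tensor. Qed.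

Definition iota (u : L) : T := tensor [:: u].

Lemma tensorE s : tensor s = \prod_(u <- s) iota u.
Proof.
elim: s => [|u s IHs]; first by rewrite big_nil.
by rewrite big_cons -IHs -tensor_cat.
Qed.

(* Move the i-th letter (i < size s) to the front. *)
Definition to_front (s : seq L) (i : nat) : seq L :=
  nth 0 s i :: take i s ++ drop i.+1 s.

Definition tprime_word (s : seq L) : T :=
  \sum_(i < size s) tensor (to_front s i).

Definition tprime : T -> T := tlift tprime_word.

Fact to_front_cat_l s (u : L) t i : (i < size s)%N ->
  to_front (s ++ u :: t) i = (nth 0 s i :: take i s ++ drop i.+1 s) ++ u :: t.
Proof.
move=> lti; rewrite /to_front nth_cat lti takel_cat ?(ltnW lti) //.
rewrite drop_cat /= -catA; congr (_ :: _ ++ _).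
case: ltnP => // le_s; have -> : i.+1 = size s by apply/eqP; rewrite eqn_leq lti.
by rewrite subnn drop0 drop_size.
Qed.

Fact to_front_cat_m s (u : L) t : to_front (s ++ u :: t) (size s) = u :: s ++ t.
Proof.
by rewrite /to_front nth_cat ltnn subnn take_size_cat // drop_cat ltnNge leqnSn /=
  subSnn /= drop0.
Qed.

Fact to_front_cat_r s (u : L) t i :
  to_front (s ++ u :: t) (size s + i.+1)
  = (nth 0 t i :: s) ++ u :: (take i t ++ drop i.+1 t).
Proof.
rewrite /to_front nth_cat ltnNge leq_addr /= addKn /= take_cat ltnNge leq_addr /=.
by rewrite addKn /= -addnS drop_cat ltnNge leq_addr /= addKn /= -catA.
Qed.

Fact tprime_word_cat s (u : L) t : tprime_word (s ++ u :: t) =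
  \sum_(i < size s) tensor ((nth 0 s i :: take i s ++ drop i.+1 s) ++ u :: t)
  + (tensor (u :: s ++ t)
  + \sum_(i < size t) tensor ((nth 0 t i :: s) ++ u :: (take i t ++ drop i.+1 t))).
Proof.
rewrite /tprime_word size_cat /= big_split_ord /= big_ord_recl /=.
rewrite addn0 to_front_cat_m; congr (_ + (_ + _)); apply: eq_bigr => i _.
  by rewrite to_front_cat_l.
congr tensor; exact: to_front_cat_r.
Qed.

Fact tprime_multilinear : multilinear tprime_word.
Proof.
move=> s t a u v; rewrite !tprime_word_cat !scalerDr.
under eq_bigr do rewrite tensor_lin.
under [X in _ + (_ + X) = _]eq_bigr do rewrite tensor_lin.
rewrite !big_split /= -!scaler_sumr -[(a *: u + v) :: _]/([::] ++ _ :: _).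
by rewrite tensor_lin [RHS]addrACA; congr (_ + _); apply: addrACA.
Qed.

Fact tprime_is_linear : linear tprime.
Proof. exact: tlift_linear tprime_multilinear. Qed.
HB.instance Definition _ :=
  GRing.isLinear.Build k T T *:%R tprime tprime_is_linear.

Lemma tprime_tensor (s : seq L) :
  tprime (tensor s)
  = \sum_(i < size s) tensor (nth 0 s i :: take i s ++ drop i.+1 s).
Proof. exact: tlift_tensor tprime_multilinear. Qed.

Definition bracket (A B : set T) : set T :=
  span [set x * y - y * x | x in A & y in B].

Definition mul_submod (A B : set T) : set T :=
  span [set x * y | x in A & y in B].

(* The sum of a family of submodules. *)
Definition sum_submod (A : nat -> set T) : set T :=
  span (\bigcup_i A i).

(* Lprime n is L'_{n+1}. *)
Fixpoint Lprime (n : nat) : set T :=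
  if n is m.+1 then bracket (range iota) (Lprime m) else range iota.

Definition gbar' : set T := sum_submod (fun n => Lprime n.+1).

Fixpoint pow_submod (U : set T) (n : nat) : set T :=
  if n is m.+1 then mul_submod U (pow_submod U m) else range (fun a : k => a *: (1 : T)).

Definition star (U : set T) : set T := sum_submod (pow_submod U).

Definition Ker (f : T -> T) : set T := [set z | f z = 0].

End TensorAlgebra.

Arguments tprime {k} L z.
Arguments Lprime {k} L n.
Arguments gbar' {k} L.

(* Main.v *)
(** For each basis element [b] of [L], stripping the first letter [b] (sending
words that start with another letter to 0) after [t'] gives the derivation
[d_b] of [T(L)] with [d_b(b') = delta_{b,b'}]; it kills [g'], hence the
subalgebra [S] generated by [g'].  For a finite set [X] of basis elements, let
[S_X] be the subalgebra generated by [S] and [X].  It is stable under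
commutators with elements of [L], so [S_{X+b}] is the sum of the [b^j S_X].
If [z = sum_{j <= n} b^j y_j] with [y_j] in [S_X], then [d_b^n z = n! y_n]; as
[T(L)] is torsionfree, [d_b z = 0] forces [z] to lie in [S_X].  Every element of
[Ker t'] lies in some [S_X], so removing the elements of [X] one at a time puts
it in [S]. *)

Require Import Defs.
From HB Require Import structures.
From mathcomp Require Import all_boot all_algebra.
From mathcomp Require Import finmap.
From mathcomp Require Import boolp classical_sets.
From mathcomp.multinomials Require Import monalg.

Set Implicit Arguments.
Unset Strict Implicit.
Unset Printing Implicit Defensive.

Import Defs GRing.Theory.
Local Open Scope classical_set_scope.
Local Open Scope ring_scope.

(** * Linear spans and linear maps *)

Section Span.
Variables (k : comPzRingType) (V : lmodType k).

Lemma span_le (S P : set V) :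
  P 0 -> (forall x y, P x -> P y -> P (x + y)) ->
  (forall a x, P x -> P (a *: x)) -> S `<=` P -> span S `<=` P.
Proof.
move=> P0 PD PZ SP; apply: span_ind => // a x y /SP Px Py.
by apply: PD => //; apply: PZ.
Qed.

Lemma span_lin (W : lmodType k) (f : {linear V -> W}) (S : set V) (P : set W) :
  (forall x, S x -> span P (f x)) -> forall x, span S x -> span P (f x).
Proof.
move=> SP; apply: span_le => [|x y Px Py|a x Px|//] /=.
- by rewrite linear0; apply: span0.
- by rewrite linearD; apply: spanD.
- by rewrite linearZ; apply: spanZ.
Qed.

Lemma span_ker (W : lmodType k) (f : {linear V -> W}) (S : set V) :
  (forall x, S x -> f x = 0) -> forall x, span S x -> f x = 0.
Proof.
move=> S0; apply: span_le => [|x y fx fy|a x fx|//] /=.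
- by rewrite linear0.
- by rewrite linearD fx fy addr0.
- by rewrite linearZ /= fx scaler0.
Qed.

End Span.

(** * Coordinates with respect to a basis *)

Section FreeSection.
Variables (k : comPzRingType) (L : lmodType k).

(* The section [s] takes the coordinates of a vector in the basis [B]. *)
Lemma free_section : is_free L ->
  exists (B : set L) (s : {linear L -> freemod k L}),
    [/\ span B = setT, forall u, lext id (s u) = u
      & forall b, B b -> s b = gen k b].
Proof.
move=> [B [indB spanB]].
(* On formal combinations supported in [B], evaluation [lext id] is injective by independence and
   surjective by spanning; [s] is its inverse. *)
pose inB (g : freemod k L) := forall x, coef x g <> 0 -> B x.
have inB_lin a g h : inB g -> inB h -> inB (a *: g + h).
  move=> gB hB x; rewrite coefD coefZ => nz.
  have [g0|/eqP/gB//] := eqVneq (coef x g) 0.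
  by apply: hB => h0; apply: nz; rewrite g0 h0 mulr0 addr0.
have inB_gen b : B b -> inB (gen k b).
  by move=> Bb x; rewrite coef_gen; case: eqP => [<-|].
have inB_inj g h : inB g -> inB h -> lext id g = lext id h -> g = h.
  move=> gB hB egh; apply/eqP; rewrite -subr_eq0; apply/eqP.
  have dB : inB (g - h) by rewrite addrC -scaleN1r; apply: inB_lin.
  have d0 : lext id (g - h) = 0 by rewrite lextB egh subrr.
  apply/freemodP => x; rewrite [RHS]mcoeff0.
  have [xd|] := boolP (x \in msupp (g - h)); last exact: coef_supp.
  apply: (indB (msupp (g - h)) (fun y => coef y (g - h))) xd => [|y|].
  - exact: fset_uniq.
  - rewrite -mcoeff_neq0 => /eqP; exact: dB.
  - exact: d0.
have ex u : exists g, inB g /\ lext id g = u.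
  have : span B u by rewrite spanB.
  move: u; apply: span_ind => [|a x _ Bx [g [gB <-]]].
    by exists 0; rewrite linear0; split=> // x; rewrite /coef mcoeff0.
  exists (a *: gen k x + g); rewrite lextP lext_gen; split=> //.
  by apply: inB_lin => //; apply: inB_gen.
have [s sP] := choice ex.
(* The choice of preimages is forced by injectivity, hence linear. *)
have s_lin : linear s.
  move=> a u v; apply: inB_inj; first exact: (sP _).1.
    by apply: inB_lin; apply: (sP _).1.
  by rewrite lextP !(sP _).2.
pose sl : {linear L -> freemod k L} :=
  HB.pack s (GRing.isLinear.Build k L (freemod k L) *:%R s s_lin).
exists B, sl; split=> // [u|b Bb]; first exact: (sP u).2.
apply: inB_inj; first exact: (sP b).1; first exact: inB_gen.
by rewrite (sP b).2 lext_gen.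
Qed.

End FreeSection.

(** * Torsionfreeness of T(L) *)

Section TensorAlgebra.
Variables (k : comPzRingType) (L : lmodType k).
Local Notation T := (tensor_alg L).
Implicit Types (u v : L) (s t : seq L) (x y z : T).

Fact iota_is_linear : linear (@iota k L).
Proof. by move=> a u v; apply: (tensor_lin [::] [::]). Qed.
HB.instance Definition _ :=
  GRing.isLinear.Build k L T *:%R (@iota k L) iota_is_linear.

Lemma tensor_cons u s : tensor (u :: s) = iota u * tensor s.
Proof. exact: (tensor_cat [:: u]). Qed.

(* Expanding every letter of a word in the basis is a linear section of the
   projection from the free module on words to [T(L)]; so [T(L)] embeds in a free
   module. *)
Section Torsion.
Variable sec : {linear L -> freemod k L}.
Hypothesis secK : forall u, lext id (sec u) = u.
Local Notation F := (freemod k (seq L)).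

(** The bilinear product of a combination of letters and a combination of words, formed before
    passing to the quotient T(L). *)
Let prefix (p : freemod k L) (g : F) : F :=
  lext (fun u => lext (fun w => gen k (u :: w)) g) p.

Let prefixPr p a g h : prefix p (a *: g + h) = a *: prefix p g + prefix p h.
Proof.
rewrite /prefix /lext scaler_sumr -big_split; apply: eq_bigr => x _ /=.
by rewrite -!/(lext _ _) lextP scalerDr !scalerA mulrC.
Qed.

Let tpi_prefix p g : tpi (prefix p g) = iota (lext id p) * tpi g.
Proof.
rewrite /prefix; elim/freemod_ind: p => [|a x p IH].
  by rewrite !linear0 mul0r.
rewrite !lextP !lext_gen !linearP /= IH mulrDl -ta_scalerAl.
congr (_ *: _ + _); elim/freemod_ind: g {p IH} => [|b w g IH].
  by rewrite !linear0 mulr0.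
by rewrite lextP lext_gen !linearP /= IH mulrDr -ta_scalerAr -tensor_cons.
Qed.

Let tsec_word s : F := foldr (fun u => prefix (sec u)) (gen k [::]) s.

Let tsec_multilinear : multilinear tsec_word.
Proof.
move=> s t a u v; elim: s => [|w s IH] /=; first by rewrite linearP /prefix lextP.
by rewrite IH prefixPr.
Qed.

Let tsecK z : tpi (tlift tsec_word z) = z.
Proof.
elim/tensor_ind: z => [|a s z IH].
  by rewrite -tpi0 tlift_tpi // linear0.
rewrite tlift_linear // tlift_tensor // linearP /= IH.
congr (_ *: _ + _); elim: s => //= u s IHs.
by rewrite tpi_prefix secK IHs -tensor_cons.
Qed.

Lemma tensor_alg_torsionfree : torsionfree k -> torsionfree T.
Proof.
(* By [tsecK] it suffices that the section sends z to 0, and this can be tested on each coefficient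
   in k. *)
move=> tfk n z n_gt0 nz0; rewrite -[z]tsecK -tpi0; congr tpi.
apply/freemodP => w; rewrite [RHS]mcoeff0; apply: (tfk n) => //.
have lin := tlift_linear tsec_multilinear.
pose ts : {linear T -> F} :=
  HB.pack (tlift tsec_word) (GRing.isLinear.Build k T F *:%R _ lin).
rewrite /coef -mcoeffMn -[tlift _ z]/(ts z) -raddfMn nz0 raddf0.
exact: mcoeff0.
Qed.

End Torsion.

(** * Maps acting on the first letter *)

Definition head_word (g : L -> T) s : T :=
  if s is v :: s' then g v * tensor s' else 0.

(** With g = [insert y] this puts y right behind the first letter; with g = [coord_scalar] it strips
    the first letter, keeping a coordinate of it as coefficient. *)
Definition head_map (g : L -> T) : T -> T := tlift (head_word g).

Section HeadMap.
Variable g : {linear L -> T}.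

Fact head_multilinear : multilinear (head_word g).
Proof.
move=> [|w s] t a u v /=; first by rewrite linearP mulrDl -ta_scalerAl.
by rewrite tensor_lin mulrDr -ta_scalerAr.
Qed.

HB.instance Definition _ :=
  GRing.isLinear.Build k T T *:%R (head_map g) (tlift_linear head_multilinear).

Lemma head_map_tensor s : head_map g (tensor s) = head_word g s.
Proof. exact: tlift_tensor head_multilinear. Qed.

Lemma head_map_iotaM v z : head_map g (iota v * z) = g v * z.
Proof.
elim/tensor_ind: z => [|a s z IH]; first by rewrite !mulr0 linear0.
rewrite !mulrDr -!ta_scalerAr linearP /= IH; congr (_ *: _ + _).
by rewrite -tensor_cons head_map_tensor.
Qed.

Lemma head_map_iota v : head_map g (iota v) = g v.
Proof. by rewrite -[iota v]mulr1 head_map_iotaM mulr1. Qed.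

(** Every word of t'(z) is nonempty, so its first letter is not affected by multiplication on the
    right. For a constant in place of t'(z) this would fail. *)
Lemma head_map_tprimeM z y : head_map g (tprime L z * y) = head_map g (tprime L z) * y.
Proof.
elim/tensor_ind: z => [|a s z IH]; first by rewrite !linear0 mul0r linear0.
rewrite 2!linearP /= !mulrDl -!ta_scalerAl linearP /= IH; congr (_ *: _ + _).
rewrite tprime_tensor mulr_suml !linear_sum /= mulr_suml; apply: eq_bigr => i _.
by rewrite tensor_cons -mulrA !head_map_iotaM mulrA.
Qed.

End HeadMap.

(** * Product rule for t' and the inclusion into the kernel *)

Definition insert y v : T := iota v * y.

Fact insert_is_linear y : linear (insert y).
Proof. by move=> a u v; rewrite /insert linearP mulrDl -ta_scalerAl. Qed.
HB.instance Definition _ y :=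
  GRing.isLinear.Build k L T *:%R (insert y) (insert_is_linear y).

Lemma head_map_insertP a x y z : head_map (insert (a *: x + y)) z =
  a *: head_map (insert x) z + head_map (insert y) z.
Proof.
elim/tensor_ind: z => [|b s z IH]; first by rewrite !linear0 addr0.
rewrite !linearP /= IH [RHS]addrACA -scalerDr.
congr (_ *: _ + _); rewrite !head_map_tensor.
case: s => [|v s] /=; first by rewrite scaler0 addr0.
by rewrite /insert mulrDr -ta_scalerAr mulrDl -ta_scalerAl.
Qed.

(** The letter moved to the front comes either from y, which leaves x alone, or from x, and then y
    ends up right behind it. *)
Lemma tprimeM y x :
  tprime L (y * x) = tprime L y * x + head_map (insert y) (tprime L x).
Proof.
elim/tensor_ind: y => [|a s y IH].
  have h0 z : head_map (insert 0) z = 0.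
    by have := head_map_insertP (-1) 0 0 z; rewrite !scaleN1r oppr0 addr0 addNr.
  by rewrite mul0r linear0 mul0r h0 addr0.
rewrite mulrDl -ta_scalerAl !linearP /= IH mulrDl -ta_scalerAl head_map_insertP.
rewrite addrACA -scalerDr; congr (_ *: _ + _) => {y IH}.
elim/tensor_ind: x => [|b t x IH].
  by rewrite mulr0 !linear0 mulr0 addr0.
rewrite !mulrDr -!ta_scalerAr !linearP /= IH [RHS]addrACA -scalerDr.
congr (_ *: _ + _) => {x IH}.
rewrite -tensor_cat !tprime_tensor size_cat big_split_ord /= mulr_suml linear_sum.
congr (_ + _); apply: eq_bigr => i _ /=.
  rewrite -tensor_cat nth_cat ltn_ord takel_cat 1?ltnW ?ltn_ord //=.
  (* If the moved letter is the last one of [s], nothing of [s] remains after it. *)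
  rewrite drop_cat -catA; case: ltnP => // les.
  have -> : i.+1 = size s by apply/eqP; rewrite eqn_leq les ltn_ord.
  by rewrite subnn drop0 drop_size.
rewrite head_map_tensor /= /insert -mulrA -tensor_cat -tensor_cons.
rewrite nth_cat ltnNge leq_addr /= addKn take_cat ltnNge leq_addr /= addKn.
by rewrite -addnS drop_cat ltnNge leq_addr /= addKn catA.
Qed.

Lemma tprime_iota u : tprime L (iota u) = iota u.
Proof. by rewrite /iota tprime_tensor big_ord1. Qed.

Lemma tprime1 : tprime L 1 = 0.
Proof. by rewrite -tensor_nil tprime_tensor big_ord0. Qed.

Lemma tprime_mul0 x y : tprime L x = 0 -> tprime L y = 0 -> tprime L (x * y) = 0.
Proof. by move=> x0 y0; rewrite tprimeM x0 y0 mul0r linear0 addr0. Qed.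

(** For letters, t'(uv) = uv + vu is symmetric in u and v. If t'(x) = 0, then t'(ux) and t'(xu) both
    equal ux. *)
Lemma tprime_Lprime n z : Lprime L n.+1 z -> tprime L z = 0.
Proof.
elim: n z => [|n IHn] z; apply: span_ker => {}z [_ [u _ <-]].
  case=> _ [v _ <-] <-; rewrite linearB /= !tprimeM !tprime_iota !head_map_iota.
  by rewrite /insert [X in X - _]addrC subrr.
case=> x /IHn x0 <-; rewrite linearB /= !tprimeM x0 tprime_iota head_map_iota.
by rewrite mul0r linear0 addr0 add0r subrr.
Qed.

Lemma tprime_gbar' z : gbar' L z -> tprime L z = 0.
Proof. by apply: span_ker => {}z [n _ /tprime_Lprime]. Qed.

Lemma star_gbar'_sub_Ker : star (gbar' L) `<=` Ker (tprime L).
Proof.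
apply: span_ker => z [n _]; elim: n z => [|n IHn] z /=.
  by case=> a _ <-; rewrite linearZ /= tprime1 scaler0.
apply: span_ker => _ [x gx [y /IHn y0 <-]].
by apply: tprime_mul0 => //; apply: tprime_gbar'.
Qed.

(** * Generated subalgebras *)

Inductive subalg (G : set T) : T -> Prop :=
| subalg0 : subalg G 0
| subalg1 : subalg G 1
| subalg_gen x : G x -> subalg G x
| subalgD x y : subalg G x -> subalg G y -> subalg G (x + y)
| subalgM x y : subalg G x -> subalg G y -> subalg G (x * y)
| subalgZ a x : subalg G x -> subalg G (a *: x).

Lemma subalgS (G H : set T) : G `<=` H -> subalg G `<=` subalg H.
Proof.
move=> GH x; elim=> {x} [||x /GH|x y _ ? _ ?|x y _ ? _ ?|a x _ ?].
- exact: subalg0.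
- exact: subalg1.
- exact: subalg_gen.
- exact: subalgD.
- exact: subalgM.
- exact: subalgZ.
Qed.

(** The point is that [star U] is closed under products. A left factor in U raises the exponent by
    one; left factors in a power of U follow by induction, and all others by linearity. *)
Lemma subalg_sub_star (U : set T) : subalg U `<=` star U.
Proof.
have sUM x y : U x -> star U y -> star U (x * y).
  move=> Ux; move: y.
  apply: span_le => [|y z|a y|y [n _ Uy]] /=.
  - by rewrite mulr0; apply: span0.
  - by rewrite mulrDr; apply: spanD.
  - by rewrite -ta_scalerAr; apply: spanZ.
  - apply: span_gen; exists n.+1 => //; apply: span_gen.
    by exists x => //; exists y.
have sPM n x y : pow_submod U n x -> star U y -> star U (x * y).
  move=> Ux sy; elim: n x Ux => [|n IHn] x /=.
    by case=> a _ <-; rewrite -ta_scalerAl mul1r; apply: spanZ.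
  move: x; apply: span_le => [|x z|a x|_ [x Ux [z Uz <-]]] /=.
  - by rewrite mul0r; apply: span0.
  - by rewrite mulrDl; apply: spanD.
  - by rewrite -ta_scalerAl; apply: spanZ.
  - by rewrite -mulrA; apply: sUM => //; apply: IHn.
have s1 : star U 1.
  by apply: span_gen; exists 0%N => //; exists 1; rewrite ?scale1r.
move=> x; elim=> {x} [||x Ux|x y _ sx _ sy|x y _ + _ sy|a x _ sx] //.
- exact: span0.
- by rewrite -[x]mulr1; apply: sUM.
- exact: spanD.
- move: x; apply: span_le => [|x z|a x|x [n _ Ux]] /=.
  + by rewrite mul0r; apply: span0.
  + by rewrite mulrDl; apply: spanD.
  + by rewrite -ta_scalerAl; apply: spanZ.
  + exact: (sPM n).
- exact: spanZ.
Qed.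

(** * The subalgebras S_X ([adjoin X]) and expansions in powers of b *)

Definition adjoin (X : seq L) : set T :=
  subalg (gbar' L `|` [set z | exists2 u, u \in X & z = iota u]).

Lemma adjoin_iota X u : u \in X -> adjoin X (iota u).
Proof. by move=> Xu; apply: subalg_gen; right; exists u. Qed.

Lemma adjoinS X Y : {subset X <= Y} -> adjoin X `<=` adjoin Y.
Proof.
move=> XY; apply: subalgS => z [gz|[u Xu ->]]; first by left.
by right; exists u => //; apply: XY.
Qed.

(** Commutation with u is a derivation, so generators suffice. Both kinds of generators, letters
    included, are sent into [gbar'], whence u may be any element of L. *)
Lemma adjoin_commutator X u z : adjoin X z -> adjoin X (iota u * z - z * iota u).
Proof.
(* The index is shifted: n = 0 is the case of a letter y, whose commutator with u lies in L'_2. *)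
have comm_gen n y : Lprime L n y -> gbar' L (iota u * y - y * iota u).
  move=> Ly; apply: span_gen; exists n => //; apply: span_gen.
  by exists (iota u); [exists u | exists y].
elim=> {z} [||x|x y _ IHx _ IHy|x y gx IHx gy IHy|a x _ IHx].
- by rewrite mulr0 mul0r subr0; apply: subalg0.
- by rewrite mulr1 mul1r subrr; apply: subalg0.
- move=> [gx|[v Xv ->]]; apply: subalg_gen; left; last first.
    by apply: (comm_gen 0%N); exists v.
  move: x gx; apply: span_le => [|x y gx gy|a x gx|x [n _ Lx]] /=.
  + by rewrite mulr0 mul0r subr0; apply: span0.
  + by rewrite mulrDr mulrDl opprD addrACA; apply: spanD.
  + by rewrite -ta_scalerAr -ta_scalerAl -scalerBr; apply: spanZ.
  + exact: comm_gen Lx.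
- by rewrite mulrDr mulrDl opprD addrACA; apply: subalgD.
- have -> : iota u * (x * y) - x * y * iota u =
      (iota u * x - x * iota u) * y + x * (iota u * y - y * iota u).
    by rewrite mulrBl mulrBr !mulrA addrA subrK.
  by apply: subalgD; apply: subalgM.
- by rewrite -ta_scalerAr -ta_scalerAl -scalerBr; apply: subalgZ.
Qed.

(** The bound on j is strict, so n = 0 gives the zero module and n = 1 gives S_X. *)
Definition pow_span b X n : set T :=
  span [set z | exists j y, [/\ (j < n)%N, adjoin X y & z = iota b ^+ j * y]].

Lemma pow_spanS b X m n : (m <= n)%N -> pow_span b X m `<=` pow_span b X n.
Proof.
move=> le_mn; apply: span_le => [|x y|a x|z [j [y [ltj Xy ->]]]].
- exact: span0.
- exact: spanD.
- exact: spanZ.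
- by apply: span_gen; exists j, y; split=> //; apply: leq_trans le_mn.
Qed.

(** The expandable elements contain 1 and are stable under left multiplication by every generator of
    the larger algebra. *)
Lemma adjoin_cons b X z : adjoin (b :: X) z -> exists n, pow_span b X n z.
Proof.
pose D z := exists n, pow_span b X n z.
have D0 : D 0 by exists 0%N; apply: span0.
have DD x y : D x -> D y -> D (x + y).
  move=> [m Dx] [n Dy]; exists (maxn m n); apply: spanD.
    exact: pow_spanS (leq_maxl _ _) _ Dx.
  exact: pow_spanS (leq_maxr _ _) _ Dy.
have DZ a x : D x -> D (a *: x) by move=> [n Dx]; exists n; apply: spanZ.
have Dgen j y : adjoin X y -> D (iota b ^+ j * y).
  by move=> Xy; exists j.+1; apply: span_gen; exists j, y.
have Dspan (f : T -> T) : linear f -> (forall j y, adjoin X y -> D (f (iota b ^+ j * y))) ->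
    forall x, D x -> D (f x).
  move=> f_lin Df x [n]; move: x.
  pose fl : {linear T -> T} := HB.pack f (GRing.isLinear.Build k T T *:%R f f_lin).
  apply: span_le => [|x y|a x|_ [j [y [_ Xy ->]]]] /=.
  - by rewrite -[f]/(fl : T -> T) linear0.
  - by rewrite -[f]/(fl : T -> T) linearD; apply: DD.
  - by rewrite -[f]/(fl : T -> T) linearZ; apply: DZ.
  - exact: Df.
have Db x : D x -> D (iota b * x).
  apply: Dspan => [a y z'|j y Xy]; first by rewrite mulrDr -ta_scalerAr.
  by rewrite mulrA -exprS; apply: Dgen.
have DX y x : adjoin X y -> D x -> D (y * x).
  move=> Xy; apply: Dspan => [a x' z'|j w Xw]; first by rewrite mulrDr -ta_scalerAr.
  elim: j y Xy => [|j IHj] y Xy.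
    by rewrite expr0 mul1r -[y * w]mul1r; apply: (Dgen 0%N); apply: subalgM.
  (* Move y past one b. The correction has [b,y] in place of y, again in S_X, which is why the
     induction on j is over all y. *)
  have -> : y * (iota b ^+ j.+1 * w) = iota b * (y * (iota b ^+ j * w))
      + (-1) *: ((iota b * y - y * iota b) * (iota b ^+ j * w)).
    by rewrite scaleN1r mulrBl opprB exprS !mulrA addrC subrK.
  by apply: DD; [apply/Db/IHj | apply/DZ/IHj/adjoin_commutator].
have DM x : adjoin (b :: X) x -> forall y, D y -> D (x * y).
  elim=> {x} [||x|x y _ IHx _ IHy|x y _ IHx _ IHy|a x _ IHx].
  - by move=> w _; rewrite mul0r.
  - by move=> w; rewrite mul1r.
  - case=> [gx|[u]]; first by move=> y; apply: DX; apply: subalg_gen; left.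
    rewrite inE => /predU1P[-> -> y|Xu ->]; first exact: Db.
    by move=> y; apply: DX; apply: adjoin_iota.
  - by move=> w Dw; rewrite mulrDl; apply: DD; [apply: IHx | apply: IHy].
  - by move=> w Dw; rewrite -mulrA; apply/IHx/IHy.
  - by move=> w Dw; rewrite -ta_scalerAl; apply/DZ/IHx.
move=> /DM/(_ 1); rewrite mulr1; apply.
by rewrite -[1]mulr1; apply: (Dgen 0%N); apply: subalg1.
Qed.

(** * The derivations d_b ([deriv]) *)

Section Derivation.
Variables (sec : {linear L -> freemod k L}) (b : L).

Definition coord_scalar v : T := coef b (sec v) *: (1 : T).

Fact coord_scalar_is_linear : linear coord_scalar.
Proof.
by move=> a u v; rewrite /coord_scalar linearP coefD coefZ scalerDl scalerA.
Qed.
HB.instance Definition _ :=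
  GRing.isLinear.Build k L T *:%R coord_scalar coord_scalar_is_linear.

Definition deriv : T -> T := head_map coord_scalar \o tprime L.
HB.instance Definition _ := GRing.Linear.on deriv.

Lemma deriv_tprime0 z : tprime L z = 0 -> deriv z = 0.
Proof. by rewrite /deriv /= => ->; rewrite linear0. Qed.

Lemma deriv_iota v : deriv (iota v) = coef b (sec v) *: (1 : T).
Proof. by rewrite /deriv /= tprime_iota head_map_iota. Qed.

Lemma derivM x y : deriv (x * y) = deriv x * y + x * deriv y.
Proof.
(* In the remaining term, stripping the first letter leaves the inserted x in front, and the scalar
   coordinate commutes with x. *)
rewrite /deriv /= tprimeM linearD /= head_map_tprimeM; congr (_ + _).
elim/tensor_ind: (tprime L y) => [|a s z IH]; first by rewrite !linear0 mulr0.
rewrite !linearP /= IH mulrDr -ta_scalerAr; congr (_ *: _ + _).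
rewrite !head_map_tensor; case: s => [|v s] /=; first by rewrite linear0 mulr0.
rewrite /insert -mulrA head_map_iotaM /coord_scalar.
by rewrite -!ta_scalerAl !mul1r ta_scalerAr.
Qed.

(** A derivation vanishing on generators vanishes on the algebra: [gbar'] lies in Ker t', and the
    letters in X have b-coordinate 0. *)
Lemma deriv_adjoin X z :
  (forall u, u \in X -> coef b (sec u) = 0) -> adjoin X z -> deriv z = 0.
Proof.
move=> X0; elim=> {z} [||x|x y _ dx _ dy|x y _ dx _ dy|a x _ dx].
- by rewrite linear0.
- by apply: deriv_tprime0; apply: tprime1.
- case=> [/tprime_gbar'/deriv_tprime0//|[u /X0 u0 ->]].
  by rewrite deriv_iota u0 scale0r.
- by rewrite linearD /= dx dy addr0.
- by rewrite derivM dx dy mul0r mulr0 addr0.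
- by rewrite linearZ /= dx scaler0.
Qed.

Hypothesis b1 : coef b (sec b) = 1.

(** The usual power rule, as d_b(b) = 1. For j = 0 the truncated exponent [j.-1] is harmless, since
    the multiplicity is 0. *)
Lemma deriv_powM j y : deriv y = 0 ->
  deriv (iota b ^+ j * y) = (iota b ^+ j.-1 * y) *+ j.
Proof.
move=> dy; elim: j => [|j IHj]; first by rewrite expr0 mul1r dy.
rewrite exprS -mulrA derivM IHj deriv_iota b1 scale1r mul1r mulrS.
congr (_ + _); case: j {IHj} => [|j] /=; first by rewrite !mulr0n mulr0.
by rewrite mulrnAr mulrA -exprS.
Qed.

Variable X : seq L.
Hypothesis X0 : forall u, u \in X -> coef b (sec u) = 0.

Lemma iter_deriv_pow n y : adjoin X y ->
  iter n deriv (iota b ^+ n * y) = y *+ n`!.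
Proof.
move=> /(deriv_adjoin X0) dy; elim: n => [|n IHn]; first by rewrite expr0 mul1r.
rewrite iterSr deriv_powM //=.
have iterMn m z : iter m deriv (z *+ n.+1) = iter m deriv z *+ n.+1.
  by elim: m => //= m ->; rewrite raddfMn.
by rewrite iterMn IHn -mulrnA mulnC factS.
Qed.

(** Each application of d_b lowers the bound on the exponents of b by one. *)
Lemma iter_deriv_pow_span n z : pow_span b X n z -> iter n deriv z = 0.
Proof.
elim: n z => [|n IHn] z.
  by apply: (span_ker (f := idfun)) => x [j [y []]].
move=> Dz; rewrite iterSr; apply: IHn; move: z Dz.
apply: span_lin => _ [[|j] [y [ltj Xy ->]]] /=.
  by rewrite deriv_powM ?(deriv_adjoin X0) // mulr0n; apply: span0.
rewrite deriv_powM ?(deriv_adjoin X0) //= -scaler_nat; apply: spanZ.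
by apply: span_gen; exists j, y.
Qed.

Hypothesis tfT : torsionfree T.

Lemma deriv_eq0_adjoin z : adjoin (b :: X) z -> deriv z = 0 -> adjoin X z.
Proof.
move=> /adjoin_cons[n Dz] dz.
(* Split off a coefficient y of the highest power of b. Then induct on the bound n. *)
have top m x : pow_span b X m.+1 x ->
    exists2 y, adjoin X y & pow_span b X m (x - iota b ^+ m * y).
  move: x; apply: span_le => [|x y [x' Xx Dx] [y' Xy Dy]|a x [x' Xx Dx]|x] /=.
  - by exists 0; [apply: subalg0 | rewrite mulr0 subr0; apply: span0].
  - exists (x' + y'); first exact: subalgD.
    by rewrite mulrDr opprD addrACA; apply: spanD.
  - exists (a *: x'); first exact: subalgZ.
    by rewrite -ta_scalerAr -scalerBr; apply: spanZ.
  - case=> j [y [ltj Xy ->]]; move: ltj; rewrite ltnS leq_eqVlt.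
    case/predU1P=> [->|ltj].
      by exists y => //; rewrite subrr; apply: span0.
    exists 0; first exact: subalg0.
    by rewrite mulr0 subr0; apply: span_gen; exists j, y.
have iter_lin m x y : iter m deriv (x + y) = iter m deriv x + iter m deriv y.
  by elim: m => //= m ->; rewrite linearD.
elim: n Dz => [|n IHn] /=.
  move: {dz} z; apply: span_le => [|x y|a x|_ [j [y []]]] //.
  - exact: subalg0.
  - exact: subalgD.
  - exact: subalgZ.
(* With bound 1 the remainder is 0 and z = y already lies in S_X. *)
move=> /top[y Xy Dzy]; case: n IHn Dzy => [|n] IHn Dzy.
  have := iter_deriv_pow_span Dzy; rewrite expr0 mul1r => /eqP.
  by rewrite subr_eq0 => /eqP->.
have dnz : iter n.+1 deriv z = 0.
  by rewrite iterSr dz; elim: n {IHn Dzy} => //= n ->; rewrite linear0.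
(* The iterate of d_b kills both z and the lower powers, leaving (n+1)! y = 0. *)
have y0 : y = 0.
  apply: (tfT (fact_gt0 n.+1)); rewrite -iter_deriv_pow //.
  have := iter_lin n.+1 (z - iota b ^+ n.+1 * y) (iota b ^+ n.+1 * y).
  by rewrite subrK dnz iter_deriv_pow_span // add0r.
by apply: IHn; move: Dzy; rewrite y0 mulr0 subr0.
Qed.

End Derivation.

(** * Exhaustion of T(L) by the S_X for finite sets X of basis elements *)

Lemma adjoin_exhaust (B : set L) : span B = setT ->
  forall z, exists2 X, (forall u, u \in X -> B u) & adjoin X z.
Proof.
move=> spanB.
pose P z := exists2 X, (forall u, u \in X -> B u) & adjoin X z.
(* Concatenating the two lists lets sums and products be formed within one S_X. *)
have common (x y : T) : P x -> P y -> exists2 X, (forall u, u \in X -> B u) &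
    adjoin X x /\ adjoin X y.
  move=> [X XB Xx] [Y YB Yy]; exists (X ++ Y).
    by move=> u; rewrite mem_cat => /orP[/XB|/YB].
  by split; [apply: adjoinS Xx | apply: adjoinS Yy] => u; rewrite mem_cat => ->;
    rewrite ?orbT.
have P0 : P 0 by exists [::] => //; apply: subalg0.
have PD a x y : P x -> P y -> P (a *: x + y).
  move=> Px Py; have [X XB [Xx Xy]] := common _ _ Px Py.
  by exists X => //; apply/subalgD/Xy/subalgZ.
have Piota u : P (iota u).
  have : span B u by rewrite spanB.
  move: u; apply: span_ind => [|a u v Bu Pv] /=; first by rewrite linear0.
  rewrite linearP; apply: PD => //; exists [:: u]; last first.
    by apply: adjoin_iota; rewrite mem_head.
  by move=> v'; rewrite inE => /eqP->.
elim/tensor_ind=> // a s z IH; apply: PD => // {a z IH}.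
elim: s => [|u s IHs]; first by exists [::] => //; apply: subalg1.
have [X XB [Xu Xs]] := common _ _ (Piota u) IHs.
by exists X => //; rewrite tensor_cons; apply: subalgM.
Qed.

End TensorAlgebra.

(** * The reverse inclusion, by descent on X *)

Theorem theorem7p15 (k : comPzRingType) (L : lmodType k)
  (k_torsionfree : torsionfree k) (L_free : is_free L) :
  star (gbar' L) = Ker (tprime L).
Proof.
apply/seteqP; split=> [|z z0]; first exact: star_gbar'_sub_Ker.
have [B [sec [spanB secK secB]]] := free_section L_free.
have tfT := tensor_alg_torsionfree secK k_torsionfree.
have [X' X'B X'z] := adjoin_exhaust spanB z.
(* Duplicates are removed so that the element b taken off differs from all those left, which then
   have b-coordinate 0. *)
have [X [uX XB Xz]] : exists X, [/\ uniq X, forall u, u \in X -> B u & adjoin X z].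
  exists (undup X'); split=> [|u|]; first exact: undup_uniq.
    by rewrite mem_undup; apply: X'B.
  by apply: adjoinS X'z => u; rewrite mem_undup.
elim: X uX XB Xz => [_ _ z_gen|b X IHX /= /andP[bX uX] XB Xz].
  by apply: subalg_sub_star; move: z_gen; apply: subalgS => x [|[]].
have XB' u : u \in X -> B u by move=> Xu; apply: XB; rewrite inE Xu orbT.
apply: IHX => //; apply: (deriv_eq0_adjoin (sec := sec)) Xz _ => //.
- by rewrite secB ?coef_gen ?eqxx //; apply: XB; rewrite mem_head.
- move=> u Xu; rewrite secB ?coef_gen; last exact: XB'.
  by case: eqP bX => // <-; rewrite Xu.
- exact: deriv_tprime0.
Qed.
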